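(* Let $m\ge 2$ and let $X$ and $Y$ be Banach spaces. For every $P\in\mathcal{P}(^mX;Y)$ we have $a_n(P^* )\le \tilde a_n(P)$ for all $n\in\mathbb{N}$. Furthermore, if there exists a linear projection $\pi$ of norm $1$ from $Y^{**}$ onto $\kappa_Y(Y)$, then for every $P\in\mathcal{P}(^mX;Y)$ we have $a_n(P^* )=\tilde a_n(P)$ for all $n\in\mathbb{N}$.
   Context: Banach spaces are over $\mathbb{K}=\mathbb{R}$ or $\mathbb{C}$; $\mathbb{N}$ is the set of positive integers. $\mathcal{P}(^mX;Y)$ is the Banach space of continuous $m$-homogeneous polynomials $P:X\to Y$, i.e. maps $P(x)=A(x,\ldots,x)$ with $A:X\times\cdots\times X\to Y$ a continuous $m$-linear map, with norm $\|P\|=\sup\{\|P(x)\|:\|x\|\le 1\}$; $\mathcal{P}(^mX)=\mathcal{P}(^mX;\mathbb{K})$ and $\mathcal{L}(X;Y)=\mathcal{P}(^1X;Y)$. The map $\kappa_Y:Y\to Y^{**}$ is the canonical embedding into the bidual. The rank of $P$ is the dimension of the linear span of $P(X)$ in $Y$. The $n$-th approximation number of $P\in\mathcal{P}(^mX;Y)$ is $\tilde a_n(P)=\inf\{\|P-Q\|: Q\in\mathcal{P}(^mX;Y),\ \mathrm{rank}(Q)<n\}$; for a linear operator $T\in\mathcal{L}(X;Y)$, $a_n(T)=\inf\{\|T-L\|: L\in\mathcal{L}(X;Y),\ \mathrm{rank}(L)<n\}$. The adjoint of $P\in\mathcal{P}(^mX;Y)$ is the continuous linear operator $P^*:Y^*\to\mathcal{P}(^mX)$,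 $P^*(\varphi)(x)=\varphi(P(x))$. *)

(* Defs.v *)
From HB Require Import structures.
From mathcomp Require Import all_boot all_order all_algebra.
From mathcomp Require Import complex.
From mathcomp Require Import all_classical all_reals all_analysis.
Set Implicit Arguments.
Unset Strict Implicit.
Unset Printing Implicit Defensive.
Import Order.TTheory GRing.Theory Num.Theory.
Import numFieldNormedType.Exports.
Local Open Scope classical_set_scope.
Local Open Scope ring_scope.

Variant scalar_kind := RealScalars | ComplexScalars.

Definition scalars (R : realType) (k : scalar_kind) : numFieldType :=
  match k with
  | RealScalars => R
  | ComplexScalars => R[i]
  end.

(* Norms in a [normedModType K] take their values in [K]; [toR] and [ofR]
   transfer them to [R] (where suprema and infima are available) and back. *)
Definition toR (R : realType) (k : scalar_kind) : scalars R k -> R :=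
  match k with
  | RealScalars => fun x => x
  | ComplexScalars => fun z => complex.Re z
  end.

Definition ofR (R : realType) (k : scalar_kind) : R -> scalars R k :=
  match k with
  | RealScalars => fun x => x
  | ComplexScalars => fun x => x%:C%C
  end.

Section ScalarTransfer.
Context {R : realType} {k : scalar_kind}.
Implicit Types (x y : scalars R k) (r s : R).

Lemma ofRK : cancel (@ofR R k) (@toR R k).
Proof. by rewrite /ofR /toR; case: k. Qed.

Lemma toRK x : 0 <= x -> ofR k (toR x) = x.
Proof.
move: x; rewrite /ofR /toR /scalars; case: k => //= -[a b].
by rewrite lecE /= => /andP[/eqP -> _].
Qed.

Lemma ler_ofR r s : (ofR k r <= ofR k s) = (r <= s).
Proof. by rewrite /ofR; case: k => //=; rewrite lecR. Qed.

Lemma ofR_le_toR r x : 0 <= x -> (ofR k r <= x) = (r <= toR x).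
Proof. by move=> x0; rewrite -{1}(toRK x0) ler_ofR. Qed.

Lemma toR_le_ofR r x : 0 <= x -> (x <= ofR k r) = (toR x <= r).
Proof. by move=> x0; rewrite -{1}(toRK x0) ler_ofR. Qed.

Lemma ler_toR x y : 0 <= x -> 0 <= y -> (toR x <= toR y) = (x <= y).
Proof. by move=> x0 y0; rewrite -ler_ofR !toRK. Qed.

End ScalarTransfer.

Section HomogeneousPolynomials.
Context {K : numFieldType} (m : nat) (X Y : normedModType K).

Definition multilinear (A : ('I_m -> X) -> Y) : Prop :=
  forall (x : 'I_m -> X) (i : 'I_m), linear (fun v : X => A (dfwith x i v)).

Definition is_hpoly : {pred X -> Y} := fun P => `[<
  exists A : ('I_m -> X) -> Y,
    [/\ multilinear A,
        continuous (A : {ptws 'I_m -> X} -> Y) &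
        forall x : X, P x = A (fun _ => x)] >].

Lemma is_hpoly_submod : submod_closed is_hpoly.
Proof.
split=> [|a P Q /asboolP[A [Al Ac AE]] /asboolP[B [Bl Bc BE]]].
  apply/asboolP; exists (fun _ => 0); split=> //.
    by move=> x i a u v; rewrite scaler0 addr0.
  exact: (@cst_continuous {ptws 'I_m -> X} Y 0).
apply/asboolP; exists (fun x => a *: A x + B x); split.
- move=> x i b u v /=; rewrite Al Bl /=.
  by rewrite !scalerDr !scalerA (mulrC a b) addrACA.
- pose T := {ptws 'I_m -> X} : topologicalType.
  have Za : continuous ((fun x => a *: A x) : T -> Y).
    by move=> x; apply: (@cvgZr _ _ T (nbhs x) _ a A (A x)); exact: Ac.
  move=> x.
  apply: (@cvgD _ _ T (nbhs x) _ (fun x => a *: A x) B (a *: A x) (B x)).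
    exact: Za.
  exact: Bc.
- by move=> x /=; rewrite -AE -BE.
Qed.

HB.instance Definition _ :=
  GRing.isSubmodClosed.Build K (X -> Y) is_hpoly is_hpoly_submod.

(* The [m]-homogeneous continuous polynomials from [X] to [Y]; the norm put on
   this type below is the supremum over the closed unit ball of [X]. *)
Record hpoly := HPoly { hpoly_fun :> X -> Y; _ : hpoly_fun \in is_hpoly }.

HB.instance Definition _ := [isSub for hpoly_fun].
HB.instance Definition _ := [Choice of hpoly by <:].
HB.instance Definition _ := [SubChoice_isSubLmodule of hpoly by <:].

End HomogeneousPolynomials.

Section HomogeneousPolynomialsTheory.
Context {K : numFieldType} {m : nat} {X Y : normedModType K}.
Implicit Types P Q : hpoly m X Y.

Lemma hpolyP P : exists A : ('I_m -> X) -> Y,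
  [/\ multilinear A, continuous (A : {ptws 'I_m -> X} -> Y) &
      forall x : X, P x = A (fun _ => x)].
Proof. by case: P => P /= /asboolP. Qed.

Lemma hpolyE P Q : P =1 Q -> P = Q.
Proof. by move=> PQ; apply: val_inj; apply/funext. Qed.

Lemma hpoly_addE P Q x : (P + Q) x = P x + Q x. Proof. by []. Qed.
Lemma hpoly_scaleE a P x : (a *: P) x = a *: P x. Proof. by []. Qed.
Lemma hpoly_zeroE x : (0 : hpoly m X Y) x = 0. Proof. by []. Qed.

Lemma hpolyZ P (a : K) x : P (a *: x) = a ^+ m *: P x.
Proof.
have [A [Al _ AE]] := hpolyP P; rewrite !AE.
suff H (s : seq 'I_m) : uniq s ->
    A (fun i => if i \in s then a *: x else x) = a ^+ size s *: A (fun _ => x).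
  have := H (enum 'I_m) (enum_uniq _); rewrite size_enum_ord => <-.
  by congr A; apply/funext => i; rewrite mem_enum.
elim: s => [_|i s IH /= /andP[iNs us]]; first by rewrite expr0 scale1r.
pose f j := if j \in s then a *: x else x.
have -> : (fun j => if j \in i :: s then a *: x else x) = dfwith f i (a *: x).
  apply/funext => j; rewrite inE /f; have [->|ij] := eqVneq j i.
    by rewrite dfwithin.
  by rewrite dfwithout // eq_sym.
have A0 : A (dfwith f i 0) = 0.
  have := Al f i 0 0 0; rewrite /= scaler0 addr0 scale0r add0r => A0.
  have := Al f i 1 0 0; rewrite /= scaler0 addr0 scale1r => /esym/eqP.
  by rewrite -subr_eq0 addrK => /eqP.
have := Al f i a x 0; rewrite /= addr0 => ->.
rewrite A0 addr0 exprS -scalerA -IH //; congr (_ *: A _).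
apply/funext => j; have [->|ij] := eqVneq j i.
  by rewrite dfwithin (negbTE iNs).
by rewrite dfwithout // eq_sym.
Qed.

Lemma diag_continuous :
  continuous ((fun x _ => x) : X -> {ptws 'I_m -> X}).
Proof.
move=> x; apply/cvg_sup => i U [] V [] [W oW <-] Wx WU.
by apply: filterS WU _; apply: open_nbhs_nbhs.
Qed.

Lemma hpoly_continuous P : continuous P.
Proof.
have [A [_ Ac AE]] := hpolyP P; move=> x.
have -> : (P : X -> Y) = A \o (fun x _ => x) by apply/funext => y /=; rewrite AE.
apply: (@continuous_comp X {ptws 'I_m -> X} Y); first exact: diag_continuous.
exact: Ac.
Qed.

Lemma hpoly_bounded P :
  exists C : K, forall x, `|x| <= 1 -> `|P x| <= C.
Proof.
have /cvgrPdist_le/(_ 1 ltr01) := @hpoly_continuous P 0.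
move=> /nbhs_norm0P[e /= e0 Pe].
pose d := e / 2; have d0 : 0 < d by rewrite divr_gt0.
exists (d ^- m * (1 + `|P 0|)) => x x1.
have {Pe} : `|P 0 - P (d *: x)| <= 1.
  apply: Pe; rewrite /= normrZ gtr0_norm // (@le_lt_trans _ _ d) //.
    by rewrite ler_piMr // ltW.
  by rewrite /d ltr_pdivrMr // ltr_pMr // ltr1n.
rewrite hpolyZ distrC => H.
have : `|d ^+ m *: P x| <= 1 + `|P 0|.
  rewrite -[_ *: _](subrK (P 0)) (le_trans (ler_normD _ _)) // lerD2r.
  exact: H.
by rewrite normrZ gtr0_norm ?exprn_gt0 // ler_pdivlMl ?exprn_gt0.
Qed.

End HomogeneousPolynomialsTheory.

Section Norm.
Context {R : realType} {k : scalar_kind}.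
Local Notation K := (scalars R k).

Definition rnorm (V : normedModType K) (v : V) : R := toR `|v|.

Section NormDefinition.
Context {m : nat} {X Y : normedModType K}.
Implicit Types P Q : hpoly m X Y.

Definition hpoly_norm P : K :=
  ofR k (sup [set rnorm (P x) | x in [set x : X | `|x| <= 1]]).

Lemma hpoly_norm_ub P x : `|x| <= 1 -> `|P x| <= hpoly_norm P.
Proof.
move=> x1; rewrite toR_le_ofR //; apply: ub_le_sup; last by exists x.
have [C PC] := hpoly_bounded P; exists (toR C) => _ [y /= y1 <-].
by rewrite ler_toR // ?PC // (le_trans _ (PC _ y1)).
Qed.

Lemma hpoly_norm_le P (c : K) :
  (forall x, `|x| <= 1 -> `|P x| <= c) -> hpoly_norm P <= c.
Proof.
move=> Pc; have c0 : 0 <= c by apply: le_trans (Pc 0 _); rewrite ?normr0.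
rewrite ofR_le_toR //; apply: ge_sup.
  by exists (rnorm (P 0)); exists 0 => //=; rewrite normr0.
by move=> _ [x /= x1 <-]; rewrite ler_toR // Pc.
Qed.

Lemma hpoly_norm_ge0 P : 0 <= hpoly_norm P.
Proof. by apply: le_trans (hpoly_norm_ub P (x := 0) _); rewrite ?normr0. Qed.

Lemma hpoly_normD P Q : hpoly_norm (P + Q) <= hpoly_norm P + hpoly_norm Q.
Proof.
apply: hpoly_norm_le => x x1; rewrite hpoly_addE.
by rewrite (le_trans (ler_normD _ _)) // lerD // hpoly_norm_ub.
Qed.

Lemma hpoly_normZ (a : K) P : hpoly_norm (a *: P) = `|a| * hpoly_norm P.
Proof.
apply/eqP; rewrite eq_le; apply/andP; split.
  apply: hpoly_norm_le => x x1; rewrite hpoly_scaleE normrZ.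
  by rewrite ler_wpM2l // hpoly_norm_ub.
have [->|a0] := eqVneq a 0; first by rewrite normr0 mul0r hpoly_norm_ge0.
rewrite -ler_pdivlMl ?normr_gt0 //; apply: hpoly_norm_le => x x1.
by rewrite ler_pdivlMl ?normr_gt0 // -normrZ -hpoly_scaleE hpoly_norm_ub.
Qed.

Lemma hpoly_norm_le_exp P x : `|P x| <= hpoly_norm P * `|x| ^+ m.
Proof.
have [->|x0] := eqVneq x 0.
  rewrite normr0 -{1}(scale0r (0 : X)) hpolyZ normrZ normrX normr0 mulrC.
  by rewrite ler_wpM2r ?exprn_ge0 // hpoly_norm_ub // normr0.
have n0 : 0 < `|x| by rewrite normr_gt0.
rewrite -ler_pdivrMr ?exprn_gt0 //.
suff <- : `|P (`|x|^-1 *: x)| = `|P x| / `|x| ^+ m.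
  by apply: hpoly_norm_ub; rewrite normrZ normfV normr_id mulVf ?gt_eqF.
by rewrite hpolyZ normrZ exprVn ger0_norm ?invr_ge0 ?exprn_ge0 // mulrC.
Qed.

Lemma hpoly_norm0_eq0 P : hpoly_norm P = 0 -> P = 0.
Proof.
move=> P0; apply: hpolyE => x; apply/eqP; rewrite -normr_le0.
by have := hpoly_norm_le_exp P x; rewrite P0 mul0r.
Qed.

End NormDefinition.

HB.instance Definition _ (m : nat) (X Y : normedModType K) :=
  Lmodule_isNormed.Build K (hpoly m X Y)
    hpoly_normD hpoly_normZ hpoly_norm0_eq0.

End Norm.

Section OneHomogeneous.
Context {K : numFieldType} {X Y : normedModType K}.

Lemma hpoly1_linear (T : hpoly 1 X Y) : linear T.
Proof.
have [A [Al _ AE]] := hpolyP T => a u v; rewrite !AE.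
have := Al (fun _ => 0) ord0 a u v.
suff H w : dfwith (fun _ => 0 : X) (ord0 : 'I_1) w = (fun _ => w).
  by rewrite /= !H.
by apply/funext => i; rewrite (ord1 i) dfwithin.
Qed.

Lemma linear_is_hpoly (f : X -> Y) :
  linear f -> continuous f -> f \in @is_hpoly K 1 X Y.
Proof.
move=> fl fc; apply/asboolP; exists (fun g : 'I_1 -> X => f (g ord0)); split=> //.
  by move=> x i a u v; rewrite (ord1 i) !dfwithin fl.
move=> g; apply: (@continuous_comp {ptws 'I_1 -> X} X Y); last exact: fc.
exact: (@proj_continuous 'I_1 (fun _ => X) ord0 g).
Qed.

Lemma bounded_is_hpoly (f : X -> Y) (M : K) : 0 <= M ->
  linear f -> (forall x, `|f x| <= M * `|x|) -> f \in @is_hpoly K 1 X Y.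
Proof.
move=> M0 fl fM; apply: linear_is_hpoly => //.
pose L := GRing.isLinear.Build K X Y *:%R f fl.
pose F : {linear X -> Y} := HB.pack f L.
apply: (@bounded_linear_continuous K X Y F); apply/ex_bound; exists M.
apply/nbhs_norm0P; exists 1 => //= x /= x1.
by rewrite (le_trans (fM x)) // ler_piMr // ltW.
Qed.

End OneHomogeneous.

Section LinearSpan.
Context {K : numFieldType} {V : lmodType K}.

Definition lin_span (S : set V) : set V :=
  [set v | exists (d : nat) (a : 'I_d -> K) (u : 'I_d -> V),
     (forall i, S (u i)) /\ v = \sum_(i < d) a i *: u i].

Definition lin_indep (d : nat) (e : 'I_d -> V) : Prop :=
  forall a : 'I_d -> K, \sum_(i < d) a i *: e i = 0 -> forall i, a i = 0.

Definition has_dim (W : set V) (d : nat) : Prop :=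
  exists e : 'I_d -> V, lin_indep e /\ lin_span (range e) = W.

End LinearSpan.

Definition rank_lt (K : numFieldType) (T : Type) (V : lmodType K)
    (f : T -> V) (n : nat) : Prop :=
  exists2 d, (d < n)%N & has_dim (lin_span (range f)) d.

Section ApproximationNumbers.
Context {R : realType} {k : scalar_kind} {m : nat}.
Context {X Y : normedModType (scalars R k)}.

(* [hpoly 1 X Y] is the space of continuous linear operators, so [m = 1] gives
   the approximation numbers of an operator.  The infimum is over a nonempty
   set only for [0 < n]. *)
Definition approx_num (n : nat) (P : hpoly m X Y) : R :=
  inf [set rnorm (P - Q) | Q in [set Q : hpoly m X Y | rank_lt Q n]].

End ApproximationNumbers.

Notation dual Y := (hpoly 1 Y (scalars _ _)^o).

Section Adjoint.
Context {R : realType} {k : scalar_kind}.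
Local Notation K := (scalars R k).
Context {m : nat} {X Y : normedModType K}.

Section Composition.
Variables (P : hpoly m X Y) (phi : dual Y).

Lemma adjoint_val_is_hpoly : (phi \o P : X -> K^o) \in @is_hpoly K m X K^o.
Proof.
have [A [Al Ac AE]] := hpolyP P; apply/asboolP; exists (phi \o A); split.
- by move=> x i a u v /=; rewrite Al hpoly1_linear.
- move=> g; apply: (@continuous_comp {ptws 'I_m -> X} Y K^o); first exact: Ac.
  exact: hpoly_continuous.
- by move=> x /=; rewrite AE.
Qed.

Definition adjoint_val : hpoly m X K^o := HPoly adjoint_val_is_hpoly.

End Composition.

Lemma adjoint_is_hpoly (P : hpoly m X Y) :
  adjoint_val P \in @is_hpoly K 1 (dual Y) (hpoly m X K^o).
Proof.
apply: (@bounded_is_hpoly _ _ _ _ `|P|) => // [a phi psi|phi].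
  exact: hpolyE.
apply: hpoly_norm_le => x x1 /=.
rewrite (le_trans (hpoly_norm_le_exp phi _)) // expr1 mulrC.
by rewrite ler_wpM2r ?hpoly_norm_ge0 // hpoly_norm_ub.
Qed.

(* [adjoint P phi x = phi (P x)] *)
Definition adjoint (P : hpoly m X Y) : hpoly 1 (dual Y) (hpoly m X K^o) :=
  HPoly (adjoint_is_hpoly P).

Lemma kappa_is_hpoly (y : Y) :
  (fun phi : dual Y => phi y : K^o) \in @is_hpoly K 1 (dual Y) K^o.
Proof.
apply: (@bounded_is_hpoly _ _ _ _ `|y|) => // phi.
by rewrite (le_trans (hpoly_norm_le_exp phi _)) // expr1 mulrC.
Qed.

Definition kappa (y : Y) : dual (dual Y) := HPoly (kappa_is_hpoly y).

End Adjoint.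

(* Main.v *)
Require Import Defs.
From mathcomp Require Import all_boot all_order all_algebra.
From mathcomp Require Import all_classical all_reals all_analysis.
From mathcomp Require Import complex ring lra.
Set Implicit Arguments.
Unset Strict Implicit.
Unset Printing Implicit Defensive.
Import Order.TTheory GRing.Theory Num.Theory.
Import numFieldNormedType.Exports.
Local Open Scope classical_set_scope.
Local Open Scope ring_scope.

(** If [Q] approximates [P] and has rank [< n], then so does [Q^*] for [P^*],
with no larger error; this gives the inequality.  Conversely, let [L] have
rank [< n].  The polynomials in the range of [L] are determined by their values
at finitely many points [x_j], with at most [rank L] points:
[L phi x = \sum_j q_j x * L phi x_j] for some scalar polynomials [q_j].  Choose
[y_j] such that [kappa y_j = pi (phi |-> L phi x_j)] and put
[Q x = \sum_j q_j x *: y_j].  As [pi] fixes [kappa Y],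
[kappa (P x - Q x) = pi (phi |-> (P^* - L) phi x)], so that
[|P - Q| <= |P^* - L|], because [kappa] is isometric by Hahn-Banach. *)

(** * Hahn-Banach for a sublinear functional, real scalars acting through [iota] *)

Section HahnBanach.
Context {R : realType} {K : numFieldType} {V : lmodType K}.
Variables (iota : {rmorphism R -> K}) (p : V -> R).
Hypothesis p_subadd : forall u v, p (u + v) <= p u + p v.
Hypothesis p_poshom : forall a v, 0 <= a -> p (iota a *: v) = a * p v.

(* Graphs of linear functionals dominated by [p]: functionality follows from
   linearity and domination, as [(0, r)] in [G] forces [r <= 0] and [- r <= 0]. *)
Definition dominated_graph (G : set (V * R)) : Prop :=
  (forall a g h, G g -> G h -> G (iota a *: g.1 + h.1, a * g.2 + h.2)) /\
  (forall g, G g -> g.2 <= p g.1).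

(* The new value [c] separates the numbers [g.2 - p (g.1 - v0)] from the numbers
   [p (h.1 + v0) - h.2]. *)
Lemma dominated_graph_extend (G : set (V * R)) (v0 : V) :
  dominated_graph G -> G !=set0 -> exists c,
  dominated_graph
    [set (iota t *: v0 + g.1, t * c + g.2) | t in [set: R] & g in G].
Proof.
move=> [Glin Gp] [g0 Gg0].
pose E := [set g.2 - p (g.1 - v0) | g in G].
have Eub h : G h -> ubound E (p (h.1 + v0) - h.2).
  move=> Gh _ [g Gg <-].
  have := Gp _ (Glin 1 g h Gg Gh); rewrite /= rmorph1 scale1r mul1r.
  have := p_subadd (g.1 - v0) (h.1 + v0); rewrite addrACA addNr addr0.
  lra.
have E0 : E !=set0 by exists (g0.2 - p (g0.1 - v0)), g0.
have Ec g : G g -> g.2 - p (g.1 - v0) <= sup E.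
  by move=> Gg; apply: ub_le_sup; [exists (p (g0.1 + v0) - g0.2); exact: Eub|exists g].
have cE g : G g -> sup E <= p (g.1 + v0) - g.2.
  by move=> Gg; apply: ge_sup => //; exact: Eub.
(* Splitting [a] as [(a - 1) + 1] gives scaling without first knowing that [G] contains [(0, 0)]. *)
have Gsc a g : G g -> G (iota a *: g.1, a * g.2).
  move=> Gg; have := Glin (a - 1) g g Gg Gg.
  rewrite rmorphB rmorph1 scalerBl scale1r mulrBl mul1r.
  by rewrite addrNK addrNK.
exists (sup E); split.
  move=> a _ _ [s _ [g Gg <-]] [t _ [h Gh <-]] /=.
  exists (a * s + t) => //.
  exists (iota a *: g.1 + h.1, a * g.2 + h.2); first exact: Glin.
  rewrite /= rmorphD rmorphM scalerDr scalerA scalerDl !mulrDr mulrA mulrDl.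
  by congr (_, _); rewrite addrACA.
move=> _ [t _ [g Gg <-]] /=.
(* Dividing by the absolute value of [t] reduces domination to [cE] for positive [t] and to [Ec] for
   negative [t]. *)
have [t0|t0|->] := ltgtP t 0; last first.
- by rewrite rmorph0 scale0r mul0r !add0r; exact: Gp.
- have := cE _ (Gsc t^-1 g Gg); rewrite /= lerBrDr -(ler_pM2l t0) mulrDr mulrA.
  rewrite divff ?gt_eqF// mul1r -(p_poshom _ (ltW t0)). rewrite scalerDr scalerA -rmorphM.
  by rewrite divff ?gt_eqF// rmorph1 scale1r (addrC g.1).
- have s0 : 0 < - t by rewrite oppr_gt0.
  have := Ec _ (Gsc (- t)^-1 g Gg); rewrite /= lerBlDr -(ler_pM2l s0) mulrDr.
  rewrite mulrA divff ?gt_eqF// mul1r -(p_poshom _ (ltW s0)) scalerBr scalerA -rmorphM.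
  rewrite divff ?gt_eqF// rmorph1 scale1r rmorphN scaleNr opprK (addrC g.1).
  lra.
Qed.

Lemma hahn_banach (y : V) : exists u : V -> R,
  [/\ forall a v w, u (iota a *: v + w) = a * u v + u w,
      forall v, u v <= p v & u y = p y].
Proof.
have p0 : p 0 = 0 by rewrite -(scale0r 0) -(rmorph0 iota) p_poshom // mul0r.
(* The implication admits the empty graph, which is the union of the empty chain in Zorn's lemma. *)
pose P G := dominated_graph G /\ (G !=set0 -> G (y, p y)).
have [|G [[[Glin Gp] Gy] Gmax]] := @Zorn_bigcup _ P.
  move=> F FP Ftot; split; first split.
  - move=> a g h [A FA Ag] [B FB Bh].
    have [AB|BA] := Ftot _ _ FA FB.
      by exists B => //; apply: (FP _ FB).1.1 => //; exact: AB.
    by exists A => //; apply: (FP _ FA).1.1 => //; exact: BA.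
  - by move=> g [A FA Ag]; exact: (FP _ FA).1.2.
  - by move=> [g [A FA Ag]]; exists A => //; apply: (FP _ FA).2; exists g.
have {Gy} Gy : G (y, p y).
  (* An empty [G] is not maximal: the real line through [y], with value [p y] at [y], carries the
     larger graph [L]. For negative [t], domination of [L] follows from subadditivity and
     [p 0 = 0]. *)
  apply/Gy/set0P/eqP => G0; rewrite {}G0 in Gmax.
  have d00 : dominated_graph [set (0, 0)].
    split=> [a _ _ -> ->|_ ->] /=; last by rewrite p0.
    by rewrite scaler0 mulr0 !addr0.
  pose L := [set (iota t *: y, t * p y) | t in [set: R]].
  apply: (Gmax L); last first.
    split; last by move=> _; exists 1 => //; rewrite rmorph1 scale1r mul1r.
    split=> [a _ _ [s _ <-] [t _ <-]|_ [t _ <-]] /=.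
      exists (a * s + t) => //.
      by rewrite rmorphD rmorphM scalerDl scalerA mulrDl mulrA.
    have [t0|t0] := leP 0 t; first by rewrite p_poshom.
    have tN : 0 <= - t by rewrite oppr_ge0 ltW.
    have := p_subadd (iota t *: y) (iota (- t) *: y).
    rewrite rmorphN scaleNr subrr p0 -scaleNr -rmorphN.
    by rewrite (p_poshom _ tN) mulNr subr_ge0.
  split=> // /(_ (y, p y)); apply.
  by exists 1 => //; rewrite rmorph1 scale1r mul1r.
(* The extension of [G] by [v] contains [G], so by maximality it equals [G], and [v] already has a
   value. *)
have Gtot v : exists c, G (v, c).
  have [|c dc] := @dominated_graph_extend G v (conj Glin Gp).
    by exists (y, p y).
  pose H := [set (iota t *: v + g.1, t * c + g.2) | t in [set: R] & g in G].
  have GH : G `<=` H.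
    move=> [w r] Gw; exists 0 => //; exists (w, r) => //=.
    by rewrite rmorph0 scale0r mul0r !add0r.
  have HG : H `<=` G.
    apply: contrapT => nHG; apply: (Gmax H); first by split.
    by split=> // _; exact: GH.
  have G00 : G (0, 0).
    have := Glin (-1) _ _ Gy Gy.
    by rewrite /= rmorphN1 scaleN1r mulN1r !addNr.
  exists c; apply: HG; exists 1 => //; exists (0, 0) => //=.
  by rewrite rmorph1 scale1r mul1r !addr0.
have Gfun v r s : G (v, r) -> G (v, s) -> r = s.
  have le a b : G (v, a) -> G (v, b) -> b <= a.
    move=> Ga Gb; have := Gp _ (Glin (-1) _ _ Ga Gb).
    by rewrite /= rmorphN1 scaleN1r mulN1r addNr p0 addrC subr_le0.
  by move=> Gr Gs; apply/eqP; rewrite eq_le !le.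
have [u uG] := choice Gtot.
exists u; split=> [a v w|v|].
- exact/Gfun/(Glin a _ _ (uG v) (uG w))/uG.
- exact: Gp (uG v).
- exact: Gfun (uG y) Gy.
Qed.

End HahnBanach.

(** * Norming functionals over the real and the complex field *)

Section NormingFunctional.
Context {R : realType}.

Lemma ofR_rmorphism (k : scalar_kind) :
  exists iota : {rmorphism R -> scalars R k}, iota =1 ofR k.
Proof.
case: k; first by exists (idfun : {rmorphism R -> R}).
by exists (@real_complex R : {rmorphism R -> R[i]}).
Qed.

Lemma real_norming_functional (k : scalar_kind)
    (Y : normedModType (scalars R k)) (y : Y) : exists u : Y -> R,
  [/\ forall a v w, u (ofR k a *: v + w) = a * u v + u w,
      forall v, u v <= rnorm v & u y = rnorm y].
Proof.
have [iota iotaE] := ofR_rmorphism k.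
have ofR_rnorm (v : Y) : ofR k (rnorm v) = `|v| by rewrite toRK.
have [||u [ulin ule uy]] := @hahn_banach R _ Y iota (@rnorm R k Y) _ _ y.
- move=> v w; rewrite -(ler_ofR (k := k)) -!iotaE rmorphD !iotaE !ofR_rnorm.
  exact: ler_normD.
- move=> a v a0; apply: (can_inj (@ofRK R k)).
  rewrite -!iotaE rmorphM !iotaE !ofR_rnorm normrZ ger0_norm //.
  by rewrite -(rmorph0 iota) iotaE ler_ofR.
by exists u; split=> // a v w; rewrite -iotaE.
Qed.

(** A complex functional [f] with real part [u] must have imaginary part [- u (i v)], since
    [Re (f (i v)) = - Im (f v)]. Conversely, this formula turns a real-linear [u] into a
    complex-linear map. *)
Lemma complexified_functional (Y : normedModType R[i]) (u : Y -> R) :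
  (forall a v w, u (a%:C%C *: v + w) = a * u v + u w) ->
  linear (fun v => (u v +i* - u ('i%C *: v))%C : R[i]^o).
Proof.
move=> ulin; have u0 : u 0 = 0.
  have := ulin 1 0 0; rewrite scaler0 addr0 mul1r; lra.
have uZ a v : u (a%:C%C *: v) = a * u v by rewrite -[_ *: v]addr0 ulin u0 addr0.
have cE a b : (a +i* b)%C = a%:C%C + b%:C%C * 'i%C :> R[i].
  by simpc.
move=> [a b] v w; rewrite (cE a b) scalerDl -addrA -scalerA !ulin.
have -> : 'i%C *: (a%:C%C *: v + (b%:C%C *: ('i%C *: v) + w))
   = a%:C%C *: ('i%C *: v) + ((- b)%:C%C *: v + 'i%C *: w).
  rewrite !scalerDr !scalerA; congr (_ *: _ + (_ *: _ + _)); by simpc.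
by rewrite !ulin -(cE a b) /GRing.scale /=; simpc; congr (_ +i* _)%C; ring.
Qed.

(** Over the reals [u] itself works, the lower bound coming from its value at [- v]. Over the
    complex numbers its complexification works: the real part at [y] is already the norm of [y]. *)
Lemma norming_functional (k : scalar_kind) (Y : normedModType (scalars R k))
  (y : Y) : exists2 phi : dual Y, `|phi| <= 1 & `|y| <= `|phi y|.
Proof.
have [u [ulin ule uy]] := real_norming_functional y.
suff [f [flin fle fy]] : exists f : Y -> (scalars R k)^o,
    [/\ linear f, forall v, `|f v| <= `|v| & `|y| <= `|f y|].
  have fP : f \in @is_hpoly (scalars R k) 1 Y (scalars R k)^o.
    by apply: (bounded_is_hpoly ler01) => // v; rewrite mul1r.
  exists (HPoly fP) => //; apply: hpoly_norm_le => v v1.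
  exact: le_trans (fle v) v1.
case: k Y y u ulin ule uy => Y y u ulin ule uy.
  exists u; split; first by move=> a v w; exact: ulin.
    move=> v; rewrite ler_norml; apply/andP; split; last exact: ule.
    have := ule (- v); rewrite /rnorm /= normrN.
    have := ulin (-1) v v; rewrite /= scaleN1r addNr.
    have := ulin (-1) v 0; rewrite /= scaleN1r addr0.
    have := ulin (-1) 0 0; rewrite /= scaleN1r addr0 oppr0.
    lra.
  by rewrite uy /rnorm /= ler_norm.
have flin := @complexified_functional Y u ulin.
exists (fun v => (u v +i* - u ('i%C *: v))%C); split=> //.
- move=> v; set z : R[i] := (_ +i* _)%C.
  have [->|z0] := eqVneq z 0; first by rewrite normr0.
  (* Rotate: [z^* * z] is the value of the functional at [z^* *: v]; being real,
     it is [u (z^* *: v)]. *)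
  have : `|z| ^+ 2 <= `|z| * `|v|.
    have := flin (z^*)%C v 0; rewrite addr0 => /(congr1 (@complex.Re R)) /=.
    have -> : u 0 = 0 by have := ulin 1 0 0; rewrite scaler0 addr0 mul1r; lra.
    rewrite addr0 -/z => uz.
    have -> : `|z| ^+ 2 = (u (z^*%C *: v))%:C%C.
      by rewrite uz sqr_normc [in RHS]mulrC /z /=; simpc; congr (_ +i* _)%C; ring.
    have -> : `|z| * `|v| = `|z^*%C *: v| by rewrite normrZ !normc_def /= !sqrrN.
    rewrite -(@toRK R ComplexScalars `|z^*%C *: v|) //=.
    by rewrite lecR; exact: ule.
  by rewrite expr2 ler_pM2l // normr_gt0.
- apply: le_trans (normc_ge_Re _); rewrite /= uy.
  rewrite -(@toRK R ComplexScalars `|y|) //= lecR.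
  exact: ler_norm.
Qed.

End NormingFunctional.

(** * Linear independence, dimension and rank *)

Section Dimension.
Context {K : numFieldType}.

(** Used to bound the length of an independent family by the number of columns of a coordinate
    matrix, and to obtain a right inverse of such a matrix. *)
Lemma row_free_ker (n d : nat) (M : 'M[K]_(n, d)) :
  (forall a : 'I_n -> K,
     (forall j, \sum_i a i * M i j = 0) -> forall i, a i = 0) ->
  row_free M.
Proof.
move=> kerM; rewrite -kermx_eq0; apply/eqP/matrixP => i j.
transitivity (0 : K); last by rewrite [RHS]mxE.
move: j; apply: kerM => l; have /matrixP/(_ i l) := mulmx_ker M.
by rewrite [LHS]mxE [in RHS]mxE.
Qed.

Context {V : lmodType K}.

Lemma sub_lin_span (S : set V) : S `<=` lin_span S.
Proof.
move=> v Sv; exists 1%N, (fun _ => 1), (fun _ => v).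
by rewrite big_ord1 scale1r.
Qed.

Lemma lin_span_submod (S : set V) (a : K) (u v : V) :
  lin_span S u -> lin_span S v -> lin_span S (a *: u + v).
Proof.
move=> [d [b [x [Sx ->]]]] [e [c [y [Sy ->]]]].
exists (d + e)%N, (fun i => match fintype.split i with inl j => a * b j | inr j => c j end),
  (fun i => match fintype.split i with inl j => x j | inr j => y j end); split.
  by move=> i; case: fintype.split.
rewrite big_split_ord scaler_sumr; congr (_ + _); apply: eq_bigr => i _.
  by rewrite (unsplitK (inl i)) scalerA.
by rewrite (unsplitK (inr i)).
Qed.

Lemma lin_span_min (S W : set V) : W 0 ->
  (forall (a : K) u v, W u -> W v -> W (a *: u + v)) ->
  S `<=` W -> lin_span S `<=` W.
Proof.
move=> W0 Wlin SW _ [d [a [u [Su ->]]]].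
elim/big_ind: _ => [//|x y Wx Wy|i _].
  by rewrite -[x]scale1r; exact: Wlin.
by rewrite -[_ *: _]addr0; apply: Wlin => //; exact/SW/Su.
Qed.

Lemma lin_span0 (S : set V) : lin_span S 0.
Proof.
exists 0%N, (fun _ => 0), (fun _ => 0); split; first by case.
by rewrite big_ord0.
Qed.

Lemma lin_span_range (d : nat) (e : 'I_d -> V) (v : V) :
  lin_span (range e) v -> exists c : 'I_d -> K, v = \sum_i c i *: e i.
Proof.
move: v; apply: (@lin_span_min _ (fun v => exists c, v = \sum_i c i *: e i)).
- by exists (fun _ => 0); rewrite big1 // => i _; rewrite scale0r.
- move=> a _ _ [b ->] [c ->]; exists (fun i => a * b i + c i).
  rewrite scaler_sumr -big_split; apply: eq_bigr => i _ /=.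
  by rewrite scalerDl scalerA.
- move=> _ [i _ <-]; exists (fun j => (j == i)%:R).
  rewrite (bigD1 i) //= eqxx scale1r big1 ?addr0 // => j /negbTE ->.
  by rewrite scale0r.
Qed.

(** An independent family of maximal length in [S] must span [S]. Its members stay in [S] itself, so
    that a basis of evaluations later consists of evaluations at actual points. *)
Lemma maximal_lin_indep (S : set V) (d : nat) :
  (forall n (u : 'I_n -> V), (forall i, S (u i)) -> lin_indep u -> (n <= d)%N) ->
  exists n (e : 'I_n -> V), [/\ (n <= d)%N, forall i, S (e i), lin_indep e &
    S `<=` lin_span (range e)].
Proof.
move=> Sd.
pose B n := `[< exists e : 'I_n -> V, (forall i, S (e i)) /\ lin_indep e >].
have B0 : exists n, B n.
  exists 0%N; apply/asboolP; exists (fun _ => 0).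
  by split=> [|a _] [].
have Bd n : B n -> (n <= d)%N by move=> /asboolP[e []]; exact: Sd.
case: (ex_maxnP B0 Bd) => n /asboolP[e [Se ie]] nmax.
exists n, e; split=> //; first exact: Sd ie.
move=> s Ss.
(* With [s] put in front, [e] becomes dependent by maximality; the coefficient of [s] is nonzero
   because [e] is independent, so one can solve for [s]. *)
pose f (i : 'I_n.+1) := if unlift ord0 i is Some j then e j else s.
have nif : ~ lin_indep f.
  move=> iF; have : (n.+1 <= n)%N.
    apply: nmax; apply/asboolP; exists f; split=> // i.
    by rewrite /f; case: unliftP.
  by rewrite ltnn.
have [a af a0] : exists2 a, \sum_i a i *: f i = 0 & ~ forall i, a i = 0.
  apply: contrapT => na; apply: nif => a af.
  by apply: contrapT => a0; apply: na; exists a.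
rewrite big_ord_recl in af.
have fS i : f (lift ord0 i) = e i by rewrite /f liftK.
rewrite (eq_bigr (fun i => a (lift ord0 i) *: e i)) in af; last first.
  by move=> i _; rewrite fS.
rewrite {1}/f unlift_none in af.
have b0 : a ord0 != 0.
  apply: contra_notN a0 => /eqP b0.
  rewrite b0 scale0r add0r in af.
  by move=> i; case: (unliftP ord0 i) => [j|] ->; [exact: (ie _ af)|].
have -> : s = - (a ord0)^-1 *: (\sum_(i < n) a (lift ord0 i) *: e i) + 0.
  move/eqP: af; rewrite addr_eq0 => /eqP sE.
  by rewrite addr0 scaleNr -scalerN -sE scalerA mulVf // scale1r.
apply: lin_span_submod; last exact: lin_span0.
by exists n, (fun i => a (lift ord0 i)), e; split.
Qed.

Lemma has_dim_lin_span (S : set V) (d : nat) :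
  (forall n (u : 'I_n -> V), (forall i, S (u i)) -> lin_indep u -> (n <= d)%N) ->
  exists2 n, (n <= d)%N & has_dim (lin_span S) n.
Proof.
move=> /maximal_lin_indep[n [e [nd Se ie Sspan]]].
exists n => //; exists e; split=> //; apply/seteqP; split.
  apply: lin_span_min; [exact: lin_span0|exact: lin_span_submod|].
  by move=> _ [i _ <-]; exact/sub_lin_span/Se.
by apply: lin_span_min Sspan; [exact: lin_span0|exact: lin_span_submod].
Qed.

(** Rank bounds thereby reduce to counting independent values of [f], with no basis of the span to
    exhibit. *)
Lemma rank_lt_le (T : Type) (f : T -> V) (d n : nat) : (d < n)%N ->
  (forall l (x : 'I_l -> T), lin_indep (f \o x) -> (l <= d)%N) ->
  rank_lt f n.
Proof.
move=> dn fd; have [l u fu iu|l ld ?] := @has_dim_lin_span (range f) d.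
  have /choice[x xE] : forall i, exists t, f t = u i.
    by move=> i; have [t _ <-] := fu i; exists t.
  apply: (fd _ x); suff -> : f \o x = u by [].
  by apply/funext => i /=.
by exists l => //; exact: leq_ltn_trans dn.
Qed.

End Dimension.

(** * Rank-one polynomials, linear operators and interpolation *)

Section Hpoly.
Context {K : numFieldType} {m : nat} {X Y : normedModType K}.

Lemma hpoly_sumE (d : nat) (P : 'I_d -> hpoly m X Y) (x : X) :
  (\sum_i P i) x = \sum_i P i x.
Proof. by elim/big_rec2: _ => [//|i _ Q _ <-]. Qed.

Lemma hpoly_scalev_subproof (q : hpoly m X K^o) (y : Y) :
  (fun x => q x *: y) \in @is_hpoly K m X Y.
Proof.
have [A [Al Ac AE]] := hpolyP q; apply/asboolP; exists (fun x => A x *: y).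
split=> [x i a u v|x|x] /=; last by rewrite AE.
- by rewrite Al /= scalerDl -scalerA.
- by apply: (@cvgZr_tmp _ _ {ptws 'I_m -> X} (nbhs x) _ A (A x) y); exact: Ac.
Qed.

Definition hpoly_scalev q y : hpoly m X Y := HPoly (hpoly_scalev_subproof q y).

Lemma hpoly1B (T : hpoly 1 X Y) x x' : T (x - x') = T x - T x'.
Proof.
by have := hpoly1_linear T (-1) x' x; rewrite !scaleN1r ![- _ + _]addrC.
Qed.

Lemma hpoly1_sum (T : hpoly 1 X Y) (d : nat) (a : 'I_d -> K) (x : 'I_d -> X) :
  T (\sum_i a i *: x i) = \sum_i a i *: T (x i).
Proof.
elim/big_rec2: _ => [|i y1 y2 _ <-]; last exact: hpoly1_linear.
by have := hpoly1B T 0 0; rewrite !subrr.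
Qed.

End Hpoly.

(* The evaluations [y |-> (p i y)_i] span a subspace of ['rV_d] that has a basis
   consisting of evaluations at points [x j]; [q j] are the coordinates. *)
Lemma interpolation_points (K : numFieldType) (m : nat) (X : normedModType K)
    (d : nat) (p : 'I_d -> hpoly m X K^o) :
  exists r (x : 'I_r -> X) (q : 'I_r -> hpoly m X K^o), (r <= d)%N /\
    forall i y, p i y = \sum_j q j y * p i (x j).
Proof.
pose ev y : 'rV[K]_d := \row_i p i y.
have [|r [e [rd eS ie evS]]] := @maximal_lin_indep _ _ (range ev) d.
  move=> n u _ iu; pose M := \matrix_(i < n, j < d) u i 0 j.
  suff /eqP <- : row_free M by exact: rank_leq_col.
  apply: row_free_ker => a aM; apply: iu; apply/rowP => j.
  transitivity (\sum_i a i * M i j); last by rewrite aM [RHS]mxE.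
  rewrite summxE; apply: eq_bigr => i _.
  by rewrite !mxE.
have /choice[x xE] : forall j, exists y, ev y = e j.
  by move=> j; have [y _ <-] := eS j; exists y.
pose E := \matrix_(j < r, i < d) e j 0 i.
(* The right inverse [B] recovers the coordinates of [ev y] in the basis [e] as fixed combinations
   of the [p i y]; hence these coordinates are polynomials in [y]. *)
have /row_freeP[B EB] : row_free E.
  apply: row_free_ker => a aE; apply: ie; apply/rowP => j.
  transitivity (\sum_i a i * E i j); last by rewrite aE [RHS]mxE.
  rewrite summxE; apply: eq_bigr => i _.
  by rewrite !mxE.
exists r, x, (fun j => \sum_i B i j *: p i); split=> // i y.
have [c cE] : exists c : 'I_r -> K, ev y = \sum_j c j *: e j.
  by apply: lin_span_range; apply: evS; exists y.
have evE i' : p i' y = \sum_j c j * E j i' :> K.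
  transitivity (ev y 0 i'); first by rewrite mxE.
  rewrite cE summxE. apply: eq_bigr => j _; by rewrite !mxE.
have qE j : (\sum_i B i j *: p i) y = c j.
  rewrite hpoly_sumE.
  transitivity (\sum_l c l * (E *m B) l j).
    under [RHS]eq_bigr => l _ do rewrite mxE big_distrr /=.
    rewrite exchange_big; apply: eq_bigr => l _ /=.
    transitivity (B l j * p l y); first by [].
    by rewrite evE mulrC big_distrl; apply: eq_bigr => h _ /=; rewrite mulrA.
  rewrite EB (bigD1 j) //= mxE eqxx mulr1 big1 ?addr0 // => l /negbTE lj.
  by rewrite mxE lj mulr0.
rewrite evE; apply: eq_bigr => j _; rewrite qE; congr (_ * _).
by rewrite mxE -xE mxE.
Qed.

(** * Comparison of the approximation numbers of a polynomial and its adjoint *)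

Section ApproxNum.
Context {R : realType} {k : scalar_kind}.
Local Notation K := (scalars R k).

Lemma approx_num_le (m m' n : nat) (X Y X' Y' : normedModType K)
    (P : hpoly m X Y) (P' : hpoly m' X' Y') : (0 < n)%N ->
  (forall Q : hpoly m X Y, rank_lt Q n ->
    exists2 Q' : hpoly m' X' Y', rank_lt Q' n & `|P' - Q'| <= `|P - Q|) ->
  approx_num n P' <= approx_num n P.
Proof.
move=> n0 PP'; apply: lb_le_inf.
  (* The zero polynomial has rank [0 < n], so the larger infimum is over a nonempty set. *)
  exists (rnorm (P - 0)); exists 0 => //=; apply: (@rank_lt_le _ _ _ _ 0) => //.
  move=> [//|l] x /(_ (fun _ => 1)) i0; exfalso.
  have := i0 _ ord0; rewrite big1 => [/(_ erefl)/eqP|i _].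
    by rewrite oner_eq0.
  by rewrite /= scaler0.
move=> _ [Q Qn <-]; have [Q' Q'n PQ] := PP' Q Qn.
apply: le_trans (_ : rnorm (P' - Q') <= _); last by rewrite ler_toR.
apply: ge_inf; last by exists Q'.
exists 0 => _ [S _ <-].
have <- : @rnorm R k Y' 0 = 0 by rewrite /rnorm normr0; case: (k).
by rewrite ler_toR // normr0.
Qed.

(** The composite of [phi] with [Q] depends only on the values of [phi] at a basis [e] of the span
    of the range of [Q]. Independent composites thus give independent rows of length [d]. *)
Lemma rank_lt_adjoint (m n : nat) (X Y : normedModType K) (Q : hpoly m X Y) :
  rank_lt Q n -> rank_lt (adjoint Q) n.
Proof.
move=> [d dn [e [ie eQ]]]; apply: (rank_lt_le dn) => l phi iphi.
pose M := \matrix_(i < l, j < d) phi i (e j).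
suff /eqP <- : row_free M by exact: rank_leq_col.
apply: row_free_ker => a aM; apply: iphi; apply: hpolyE => x.
rewrite hpoly_sumE hpoly_zeroE.
have [c cE] : exists c : 'I_d -> K, Q x = \sum_j c j *: e j.
  by apply: lin_span_range; rewrite eQ; apply: sub_lin_span; exists x.
transitivity (\sum_j c j * \sum_i a i * M i j); last first.
  by rewrite big1 // => j _; rewrite aM mulr0.
under [RHS]eq_bigr => j _ do rewrite big_distrr /=.
rewrite exchange_big; apply: eq_bigr => i _ /=.
transitivity (a i * phi i (Q x)); first by [].
rewrite cE hpoly1_sum big_distrr; apply: eq_bigr => j _ /=.
by rewrite mxE mulrCA.
Qed.

Lemma adjointB (m : nat) (X Y : normedModType K) (P Q : hpoly m X Y) :
  adjoint (P - Q) = adjoint P - adjoint Q.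
Proof.
by apply: hpolyE => phi; apply: hpolyE => x; rewrite /= hpoly1B.
Qed.

Lemma adjoint_norm_le (m : nat) (X Y : normedModType K) (P : hpoly m X Y) :
  `|adjoint P| <= `|P|.
Proof.
apply: hpoly_norm_le => phi phi1; apply: hpoly_norm_le => x x1.
rewrite (le_trans (hpoly_norm_le_exp phi _)) // expr1.
rewrite (le_trans (ler_wpM2l (hpoly_norm_ge0 _) (hpoly_norm_ub P x1))) //.
by rewrite ler_piMl // hpoly_norm_ge0.
Qed.

(** The bound [|L| * |x| ^+ m] places evaluation at [x] after [L] in the bidual, where [pi] can act
    on it. *)
Lemma eval_hpoly_subproof (m : nat) (X Y : normedModType K)
    (L : hpoly 1 (dual Y) (hpoly m X K^o)) (x : X) :
  (fun phi => L phi x) \in @is_hpoly K 1 (dual Y) K^o.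
Proof.
apply: (@bounded_is_hpoly _ _ _ _ (`|L| * `|x| ^+ m)).
- by rewrite mulr_ge0 // exprn_ge0.
- by move=> a phi psi; rewrite hpoly1_linear.
move=> phi; rewrite (le_trans (hpoly_norm_le_exp (L phi) _)) // mulrAC.
rewrite ler_wpM2r ?exprn_ge0 //.
by rewrite (le_trans (hpoly_norm_le_exp L phi)) // expr1.
Qed.

Definition eval_hpoly m (X Y : normedModType K)
    (L : hpoly 1 (dual Y) (hpoly m X K^o)) (x : X) : dual (dual Y) :=
  HPoly (eval_hpoly_subproof L x).

Lemma adjoint_approx (m n : nat) (X Y : normedModType K)
    (pi : hpoly 1 (dual (dual Y)) (dual (dual Y))) (P : hpoly m X Y)
    (L : hpoly 1 (dual Y) (hpoly m X K^o)) :
  (forall z, pi (pi z) = pi z) -> range pi = range (@kappa R k Y) ->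
  `|pi| <= 1 -> rank_lt L n ->
  exists2 Q : hpoly m X Y, rank_lt Q n & `|P - Q| <= `|adjoint P - L|.
Proof.
move=> pipi piE pi1 [d dn [p [ip pE]]].
have [r [x [q [rd qE]]]] := interpolation_points p.
have LE phi u : L phi u = \sum_j q j u * L phi (x j).
  have [c ->] : exists c : 'I_d -> K, L phi = \sum_i c i *: p i.
    by apply: lin_span_range; rewrite pE; apply: sub_lin_span; exists phi.
  under [RHS]eq_bigr => j _ do rewrite hpoly_sumE big_distrr /=.
  rewrite hpoly_sumE exchange_big; apply: eq_bigr => i _ /=.
  transitivity (c i * p i u); first by [].
  rewrite qE big_distrr; apply: eq_bigr => j _ /=.
  by rewrite mulrCA.
have kappa_pi y : pi (kappa y) = kappa y.
  have [z _ <-] : range pi (kappa y) by rewrite piE; exists y.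
  exact: pipi.
have /choice[y yE] : forall j, exists y, kappa y = pi (eval_hpoly L (x j)).
  move=> j; have [y _ <-] : range (@kappa R k Y) (pi (eval_hpoly L (x j))).
    by rewrite -piE; exists (eval_hpoly L (x j)).
  by exists y.
pose Q := \sum_j hpoly_scalev (q j) (y j).
have QE u : Q u = \sum_j q j u *: y j by rewrite hpoly_sumE.
exists Q.
  (* Each [Q u] is determined by the row of the [q j u], of length [r <= d], so at most [r] values
     of [Q] are independent. *)
  apply: (rank_lt_le (leq_ltn_trans rd dn)) => l u iu.
  pose M := \matrix_(i < l, j < r) q j (u i).
  suff /eqP <- : row_free M by exact: rank_leq_col.
  apply: row_free_ker => a aM; apply: iu.
  transitivity (\sum_j (\sum_i a i * M i j) *: y j); last first.
    by rewrite big1 // => j _; rewrite aM scale0r.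
  under [RHS]eq_bigr => j _ do rewrite scaler_suml.
  rewrite exchange_big; apply: eq_bigr => i _ /=.
  rewrite QE scaler_sumr; apply: eq_bigr => j _.
  by rewrite mxE scalerA.
apply: hpoly_norm_le => u u1.
(* With [pi] pulled outside the sum, the whole error is the image under [pi] of a single bidual
   element, and passing to that element costs at most the factor [|pi| <= 1]. *)
have kB : kappa (P u - Q u) =
    pi (kappa (P u) - \sum_j q j u *: eval_hpoly L (x j)).
  rewrite hpoly1B kappa_pi hpoly1_sum.
  under eq_bigr => j _ do rewrite -yE.
  apply: hpolyE => phi.
  transitivity (phi (P u) - (\sum_j q j u *: kappa (y j)) phi); last by [].
  by rewrite QE hpoly_sumE /= hpoly1B hpoly1_sum.
have [phi phi1 phiP] := norming_functional (P u - Q u).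
apply: le_trans phiP _.
have -> : phi (P u - Q u) = kappa (P u - Q u) phi by [].
apply: le_trans (hpoly_norm_ub _ phi1) _; rewrite kB.
apply: le_trans (hpoly_norm_le_exp pi _) _.
rewrite expr1 -[leRHS]mul1r ler_pM ?hpoly_norm_ge0 //.
apply: hpoly_norm_le => psi psi1.
have -> : (kappa (P u) - \sum_j q j u *: eval_hpoly L (x j)) psi =
    (adjoint P - L) psi u.
  transitivity (psi (P u) - L psi u); last by [].
  transitivity (psi (P u) - (\sum_j q j u *: eval_hpoly L (x j)) psi).
    by [].
  by rewrite hpoly_sumE LE.
apply: le_trans (hpoly_norm_ub _ u1) _.
exact: (hpoly_norm_ub (adjoint P - L) psi1).
Qed.

End ApproxNum.

Theorem proposition3p3 (R : realType) (k : scalar_kind) (m : nat)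
    (hm : (2 <= m)%N) (X Y : completeNormedModType (scalars R k)) :
  (forall (P : hpoly m X Y) (n : nat), (0 < n)%N ->
     approx_num n (adjoint P) <= approx_num n P) /\
  ((exists pi : hpoly 1 (dual (dual Y)) (dual (dual Y)),
      [/\ forall z, pi (pi z) = pi z,
          range pi = range (@kappa R k Y) &
          `|pi| = 1]) ->
   forall (P : hpoly m X Y) (n : nat), (0 < n)%N ->
     approx_num n (adjoint P) = approx_num n P).
Proof.
have le_adjoint (P : hpoly m X Y) (n : nat) : (0 < n)%N ->
    approx_num n (adjoint P) <= approx_num n P.
  move=> n0; apply: approx_num_le => // Q Qn; exists (adjoint Q).
    exact: rank_lt_adjoint.
  by rewrite -adjointB; exact: adjoint_norm_le.
split=> // -[pi [pipi piE pi1]] P n n0.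
apply/eqP; rewrite eq_le le_adjoint //=; apply: approx_num_le => // L Ln.
by apply: adjoint_approx pipi piE _ Ln; rewrite pi1.
Qed.
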